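(* Let $p=2$, $X=(X_1,X_2)\in\mathbb{R}^{n\times 2}$ with $\|X_1\|_2=\|X_2\|_2=1$ and $X_1^TX_2=-\hat\rho$, where $0<\hat\rho<1$, put $\hat\varphi^2:=1-\hat\rho$ and $S_0:=\{1,2\}$. Then $$\hat\phi^2(\{1\})=1-\hat\rho^2=\hat\varphi^2(2-\hat\varphi^2).$$ Moreover $$\hat\phi^2(S_0)=\hat\varphi^2,\qquad \hat\Gamma^2(S_0)=\frac{2}{\hat\varphi^2}.$$
   Context: For $S\subset\{1,\ldots,p\}$ and $\beta\in\mathbb{R}^p$, $\beta_S$ is the vector with entries $\beta_j$ for $j\in S$ and $0$ otherwise, and $\beta_{-S}:=\beta_{S^c}$. The compatibility constant is $\hat\phi^2(S):=\min\{|S|\,\|X\beta\|_2^2:\ \|\beta_S\|_1=1,\ \|\beta_{-S}\|_1\le 1\}$ (for $S=\{1,\ldots,p\}$ only the constraint $\|\beta_S\|_1=1$ is present), and the effective sparsity is $\hat\Gamma^2(S):=|S|/\hat\phi^2(S)$. *)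

(* Defs.v *)
From HB Require Import structures.
From mathcomp Require Import all_boot all_order all_algebra.
From mathcomp Require Import boolp classical_sets reals.

Set Implicit Arguments.
Unset Strict Implicit.
Unset Printing Implicit Defensive.

Import Order.TTheory GRing.Theory Num.Theory.

Local Open Scope ring_scope.

(* The norm `|v| of the library on matrices is the sup norm, hence the
   explicit l1 and l2 norms. *)
Definition norm1 (R : realType) (m : nat) (v : 'cV[R]_m) : R :=
  \sum_(i < m) `|v i 0|.

Definition norm2 (R : realType) (m : nat) (v : 'cV[R]_m) : R :=
  Num.sqrt (\sum_(i < m) v i 0 ^+ 2).

Definition restrict_vec (R : realType) (p : nat) (S : {set 'I_p})
    (beta : 'cV[R]_p) : 'cV[R]_p :=
  \col_(j < p) (if j \in S then beta j 0 else 0).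

(* The junk value 0 is returned when A has no smallest element; thus
   [minimum A = m] with [m != 0] asserts that the minimum is attained. *)
Definition minimum (R : realType) (A : set R) : R :=
  xget 0 [set m | A m /\ lbound A m]%classic.

(* When S is everything, restrict_vec (~: S) beta = 0, so that the second
   constraint is vacuous. *)
Definition compat_feasible (R : realType) (p : nat) (S : {set 'I_p})
    (beta : 'cV[R]_p) : Prop :=
  norm1 (restrict_vec S beta) = 1 /\ norm1 (restrict_vec (~: S)%SET beta) <= 1.

Definition compat2 (R : realType) (n p : nat) (X : 'M[R]_(n, p))
    (S : {set 'I_p}) : R :=
  minimum [set #|S|%:R * norm2 (X *m beta) ^+ 2 |
            beta in [set b : 'cV[R]_p | compat_feasible S b]]%classic.

(* Like compat2, this is the squared quantity. *)
Definition eff_sparsity2 (R : realType) (n p : nat) (X : 'M[R]_(n, p))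
    (S : {set 'I_p}) : R :=
  #|S|%:R / compat2 X S.

(* Main.v *)
(** Expanding the square, ||X b||^2 = b_1^2 + b_2^2 - 2 rho b_1 b_2. For
    S = {1} this is (b_2 - rho b_1)^2 + (1 - rho^2) b_1^2 with |b_1| = 1,
    minimal at b = (1, rho), which is feasible as rho <= 1. For S_0, put
    s = |b_1| and t = |b_2| with s + t = 1: twice the square norm is at least
    2 - 4 (1 + rho) s t >= 1 - rho, with equality at b = (1/2, 1/2). *)
Require Import Defs.
From HB Require Import structures.
From mathcomp Require Import all_boot all_order all_algebra.
From mathcomp Require Import reals.
From mathcomp Require Import classical_sets ring lra.
Import Order.TTheory GRing.Theory Num.Theory.
Local Open Scope ring_scope.

(** Two smallest elements bound each other, so by antisymmetry [xget] can only pick [m]; as [m]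
    exists, the default 0 is not reached. *)
Lemma minimum_eq (R : realType) (A : set R) (m : R) :
  A m -> lbound A m -> minimum A = m.
Proof.
move=> Am lbm; apply: xget_unique; first by split.
by move=> y [Ay lby]; apply/eqP; rewrite eq_le lby//= lbm.
Qed.

Lemma norm2_sqr (R : realType) (m : nat) (v : 'cV[R]_m) :
  norm2 v ^+ 2 = \sum_(i < m) v i 0 ^+ 2.
Proof. by rewrite sqr_sqrtr//; apply: sumr_ge0 => i _; apply: sqr_ge0. Qed.

(** The quadratic form of the Gram matrix of [X], whose diagonal entries are 1 and off-diagonal
    entries [c]. Both objectives thus become polynomials in the two coordinates of [beta]. *)
Lemma norm2_mulmx2_sqr (R : realType) (n : nat) (X : 'M[R]_(n, 2)) (c : R)
    (beta : 'cV[R]_2) :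
  norm2 (col 0 X) = 1 -> norm2 (col 1 X) = 1 ->
  (col 0 X)^T *m col 1 X = c%:M ->
  norm2 (X *m beta) ^+ 2 =
    beta 0 0 ^+ 2 + beta 1 0 ^+ 2 + 2 * c * (beta 0 0 * beta 1 0).
Proof.
move=> h0 h1 h01.
have e0 : \sum_(i < n) X i 0 ^+ 2 = 1.
  rewrite -[RHS](expr1n _ 2) -[in RHS]h0 norm2_sqr.
  by apply: eq_bigr => i _; rewrite mxE.
have e1 : \sum_(i < n) X i 1 ^+ 2 = 1.
  rewrite -[RHS](expr1n _ 2) -[in RHS]h1 norm2_sqr.
  by apply: eq_bigr => i _; rewrite mxE.
have e01 : \sum_(i < n) X i 0 * X i 1 = c.
  have := congr1 (fun M : 'M[R]_1 => M 0 0) h01.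
  rewrite !mxE eqxx mulr1n => <-.
  by apply: eq_bigr => i _; rewrite !mxE.
transitivity (\sum_(i < n)
    (beta 0 0 ^+ 2 * X i 0 ^+ 2 + beta 1 0 ^+ 2 * X i 1 ^+ 2 +
     2 * (beta 0 0 * beta 1 0) * (X i 0 * X i 1))).
  rewrite norm2_sqr; apply: eq_bigr => i _.
  rewrite mxE big_ord_recl big_ord1 (_ : lift ord0 ord0 = 1); last exact: val_inj.
  by rewrite (_ : ord0 = 0 :> 'I_2)//; ring.
by rewrite !big_split /= -!mulr_sumr e0 e1 e01; ring.
Qed.

Lemma norm1_restrict2 (R : realType) (S : {set 'I_2}) (beta : 'cV[R]_2) :
  norm1 (restrict_vec S beta) =
    (if 0 \in S then `|beta 0 0| else 0) + (if 1 \in S then `|beta 1 0| else 0).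
Proof.
rewrite /norm1 big_ord_recl big_ord1 (_ : lift ord0 ord0 = 1); last exact: val_inj.
rewrite !mxE (_ : ord0 = 0)//.
by case: (0 \in S); case: (1 \in S); rewrite ?normr0.
Qed.

(** Ordinals start at 0, so [[set 0]] is the set {1} of the English statement, and its complement is
    the other coordinate. *)
Lemma compat_feasible_set1 (R : realType) (beta : 'cV[R]_2) :
  compat_feasible [set 0]%SET beta <-> `|beta 0 0| = 1 /\ `|beta 1 0| <= 1.
Proof.
by rewrite /compat_feasible !norm1_restrict2 !inE /= addr0 add0r.
Qed.

Lemma compat_feasible_set2 (R : realType) (beta : 'cV[R]_2) :
  compat_feasible [set 0; 1]%SET beta <-> `|beta 0 0| + `|beta 1 0| = 1.
Proof.
rewrite /compat_feasible !norm1_restrict2 !inE /= addr0.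
by split=> [[]//|->]; split=> //; exact: ler01.
Qed.

Theorem lemma6p1 (R : realType) (n : nat) (X : 'M[R]_(n, 2)) (rho : R)
    (hX1 : norm2 (col 0 X) = 1) (hX2 : norm2 (col 1 X) = 1)
    (hX12 : (col 0 X)^T *m col 1 X = (- rho)%:M)
    (hrho0 : 0 < rho) (hrho1 : rho < 1) :
  let vphi2 : R := 1 - rho in
  let S0 : {set 'I_2} := [set 0; 1]%SET in
  (compat2 X [set 0]%SET = 1 - rho ^+ 2 /\
   1 - rho ^+ 2 = vphi2 * (2 - vphi2)) /\
  (compat2 X S0 = vphi2 /\ eff_sparsity2 X S0 = 2 / vphi2).
Proof.
move=> vphi2 S0.
have quad beta := norm2_mulmx2_sqr R n X (- rho) beta hX1 hX2 hX12.
have cS0 : #|S0| = 2%N by rewrite cards2.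
have compatS0 : compat2 X S0 = vphi2.
  apply: minimum_eq.
    exists (const_mx 2^-1).
      by apply/compat_feasible_set2; rewrite !mxE ger0_norm ?invr_ge0//; lra.
    by rewrite quad cS0 !mxE /vphi2; field.
  move=> _ [beta /compat_feasible_set2 hb <-]; rewrite quad cS0 /vphi2.
  have hab : beta 0 0 * beta 1 0 <= `|beta 0 0| * `|beta 1 0|.
    by rewrite -normrM ler_norm.
  (* The squares depend only on the absolute values [s] and [t]; the signs survive only in the cross
     term [q], bounded by [s * t]. *)
  rewrite -(real_normK (num_real (beta 0 0))) -(real_normK (num_real (beta 1 0))).
  move: hb hab; set s := `|_|; set t := `|_|; set q := _ * beta 1 0 => hst hq.
  have -> : t = 1 - s by lra.
  have {}hq : rho * q <= rho * (s * (1 - s)).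
    by rewrite ler_pM2l// (_ : 1 - s = t)//; lra.
  (* Since 4 s (1 - s) = 1 - (2 s - 1)^2, this is exactly the excess of 2 - 4 (1 + rho) s (1 - s)
     over 1 - rho. *)
  have : 0 <= (1 + rho) * (2 * s - 1) ^+ 2.
    by apply: mulr_ge0; [lra | exact: sqr_ge0].
  nra.
split; split=> //; last by rewrite /eff_sparsity2 compatS0 cS0.
- apply: minimum_eq.
    exists (\col_j (if j == 0 then 1 else rho)).
      apply/compat_feasible_set1; rewrite !mxE /= normr1; split=> //.
      by rewrite ger0_norm ?ltW.
    by rewrite quad cards1 !mxE /=; ring.
  move=> _ [beta /compat_feasible_set1[hb _] <-]; rewrite quad cards1.
  have hb2 : beta 0 0 ^+ 2 = 1 by rewrite -real_normK ?num_real// hb expr1n.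
  (* With [hb2], this square is the excess of the objective over 1 - rho^2. *)
  have := sqr_ge0 (beta 1 0 - rho * beta 0 0).
  rewrite sqrrB exprMn hb2; lra.
- by rewrite /vphi2; ring.
Qed.
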